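(* Let $k$ be an odd integer, let $(A,\Delta)$, $(B,\Delta')$, $(C,\Delta'')$ be degree $k$ derived $BV$ algebras and let $f:A[[t]]\to B[[t]]$, $g:B[[t]]\to C[[t]]$ be morphisms of derived $BV$ algebras. Then the composition $gf:A[[t]]\to C[[t]]$ is a morphism of derived $BV$ algebras.
   Context: $\mathbb{K}$ is a field of characteristic zero; spaces are $\mathbb{Z}$-graded, algebras are graded commutative and unitary. $\pm_K$ denotes Koszul signs. $t$ is a central variable of (even) degree $1-k$. Koszul brackets: for $\Delta\in\operatorname{End}_u(A)$ (i.e. $\Delta(\mathbf{1}_A)=0$), $\mathcal{K}(\Delta)_n(a_1,\ldots,a_n)=\sum_{i=1}^n\sum_{\sigma\in S(i,n-i)}\pm_K(-1)^{n-i}\Delta(a_{\sigma(1)}\cdots a_{\sigma(i)})a_{\sigma(i+1)}\cdots a_{\sigma(n)}$, with $S(i,n-i)$ the $(i,n-i)$-unshuffles. Cumulants: for a degree zero $f:A\to B$ with $f(\mathbf{1}_A)=\mathbf{1}_B$, $\kappa(f)_n(a_1,\ldots,a_n)=\sum_{k=1}^n\sum_{I_1\sqcup\cdots\sqcup I_k=\{1,\ldots,n\}}(-1)^{k-1}(k-1)!\pm_K\prod_{j=1}^kf(\prod_{i\in I_j}a_i)$, summed over unordered partitions into nonempty subsets. Both are applied $\mathbb{K}[[t]]$-linearly to $A[[t]]$, $B[[t]]$. Degree $k$ derived $BV$ algebra: a graded commutative unitary algebra $A$ with a degree one $\mathbb{K}[[t]]$-linear map $\Delta=\sum_{n\ge0}t^n\Delta_n$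 on $A[[t]]$, $\Delta_n\in\operatorname{End}_u(A)$, $|\Delta_n|=1+n(k-1)$, such that $\Delta^2=0$ and $\mathcal{K}(\Delta)_n(a_1,\ldots,a_n)\equiv0\pmod{t^{n-1}}$ for all $n\ge2$, $a_1,\ldots,a_n\in A$. Morphism of degree $k$ derived $BV$ algebras $(A,\Delta)\to(B,\Delta')$: a degree zero $\mathbb{K}[[t]]$-linear map $f:A[[t]]\to B[[t]]$ with $f(\mathbf{1}_A)=\mathbf{1}_B$, $f\circ\Delta=\Delta'\circ f$, and $\kappa(f)_n(a_1,\ldots,a_n)\equiv0\pmod{t^{n-1}}$ for all $n\ge2$, $a_1,\ldots,a_n\in A$. *)

(* Defs.v *)
From HB Require Import structures.
From mathcomp Require Import all_boot all_order all_algebra all_fingroup.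
From mathcomp Require Import boolp.

Set Implicit Arguments.
Unset Strict Implicit.
Unset Printing Implicit Defensive.

Import Order.TTheory GRing.Theory Num.Theory.
Local Open Scope ring_scope.

(* MathComp's [algType] forces 1 != 0, and its hierarchy has no structure joining
   [pzRingType] and [lmodType]; this record is a unital associative K-algebra,
   possibly zero. *)
Record unitalAlg (K : fieldType) := UnitalAlg {
  ua_ring : pzRingType;
  ua_scale : K -> ua_ring -> ua_ring;
  ua_scaleA : forall c d a, ua_scale c (ua_scale d a) = ua_scale (c * d) a;
  ua_scale1 : left_id 1 ua_scale;
  ua_scaleDr : right_distributive ua_scale +%R;
  ua_scaleDl : forall a, {morph ua_scale^~ a : c d / c + d};
  ua_scale_mull : forall c a b, ua_scale c (a * b) = ua_scale c a * b;
  ua_scale_mulr : forall c a b, ua_scale c (a * b) = a * ua_scale c b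
}.

Definition ua_sort (K : fieldType) (A : unitalAlg K) : Type := ua_ring A.
Coercion ua_sort : unitalAlg >-> Sortclass.

HB.instance Definition _ (K : fieldType) (A : unitalAlg K) :=
  GRing.PzRing.copy (ua_sort A) (ua_ring A).
HB.instance Definition _ (K : fieldType) (A : unitalAlg K) :=
  GRing.Zmodule_isLmodule.Build K (ua_sort A)
    (@ua_scaleA K A) (@ua_scale1 K A) (@ua_scaleDr K A) (@ua_scaleDl K A).

(* [homog i] is the component of degree i; [homog_sum] and [homog_direct] say
   that the underlying space is the direct sum of the components. *)
Record gcAlgType (K : fieldType) := GCAlgebra {
  gc_alg :> unitalAlg K;
  homog : int -> {pred gc_alg};
  homog_submod : forall i, submod_closed (homog i);
  homog_sum : forall a : gc_alg, exists (s : seq int) (x : int -> gc_alg),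
    (forall i, x i \in homog i) /\ a = \sum_(i <- s) x i;
  homog_direct : forall (s : seq int) (x : int -> gc_alg), uniq s ->
    (forall i, x i \in homog i) -> \sum_(i <- s) x i = 0 ->
    {in s, forall i, x i = 0};
  homog1 : 1 \in homog 0;
  homogM : forall i j (a b : gc_alg),
    a \in homog i -> b \in homog j -> a * b \in homog (i + j);
  homogC : forall i j (a b : gc_alg), a \in homog i -> b \in homog j ->
    b * a = (-1) ^+ (odd `|i|%N && odd `|j|%N) * (a * b)
}.
Arguments homog {K A} i : rename.

(* [series T] is T[[t]]: the sequence [u] stands for \sum_n t^n u_n. *)
Definition series (T : Type) := nat -> T.

HB.instance Definition _ (T : choiceType) := Choice.copy (series T) (nat -> T).

Section SeriesZmodule.
Variable V : zmodType.
Implicit Types u v w : series V.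

Definition series_zero : series V := fun _ => 0.
Definition series_opp u : series V := fun n => - u n.
Definition series_add u v : series V := fun n => u n + v n.

Fact series_addA : associative series_add.
Proof. by move=> u v w; apply/funext => n; apply: addrA. Qed.
Fact series_addC : commutative series_add.
Proof. by move=> u v; apply/funext => n; apply: addrC. Qed.
Fact series_add0 : left_id series_zero series_add.
Proof. by move=> u; apply/funext => n; apply: add0r. Qed.
Fact series_addN : left_inverse series_zero series_opp series_add.
Proof. by move=> u; apply/funext => n; apply: addNr. Qed.

HB.instance Definition _ := GRing.isZmodule.Build (series V)
  series_addA series_addC series_add0 series_addN.

(* The constant series, i.e. the inclusion of V in V[[t]]. *)
Definition series_const (a : V) : series V := fun n => if n == 0%N then a else 0.

End SeriesZmodule.

Fact convolution_assoc (V : zmodType) (F : nat -> nat -> nat -> V) n :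
  \sum_(i < n.+1) \sum_(j < (n - i).+1) F i j (n - i - j)%N
  = \sum_(k < n.+1) \sum_(i < k.+1) F i (k - i)%N (n - k)%N.
Proof.
have E (i : 'I_n.+1) : \sum_(j < (n - i).+1) F i j (n - i - j)%N
   = \sum_(k < n.+1 | (i <= k)%N) F i (k - i)%N (n - k)%N.
  rewrite (reindex_omap (fun j : 'I_(n - i).+1 => inord (i + j) : 'I_n.+1)
     (fun k : 'I_n.+1 => insub (k - i)%N)) /=; last first.
    move=> k ik; rewrite insubT /= ?ltnS ?leq_sub2r -1?ltnS // => H.
    by congr Some; apply: val_inj; rewrite /= inordK subnKC.
  have ij (j : 'I_(n - i).+1) : (i + j < n.+1)%N.
    by have := ltn_ord j; rewrite ltnS => le_j; rewrite ltnS -leq_subRL ?leq_ord.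
  apply: eq_big => [j|j _]; last by rewrite inordK ?ij // subnDA addKn.
  rewrite inordK ?ij // leq_addr addKn.
  by rewrite (valK j) eqxx.
under eq_bigr do rewrite E.
rewrite (exchange_big_dep predT) //=; apply: eq_bigr => k _.
by rewrite (big_ord_narrow_leq (leq_ord k)).
Qed.

Section SeriesRing.
Variable R : pzRingType.
Implicit Types u v w : series R.

Definition series_mul u v : series R :=
  fun n => \sum_(i < n.+1) u i * v (n - i)%N.

Fact series_mulA : associative series_mul.
Proof.
move=> u v w; apply/funext => n; rewrite /series_mul.
under eq_bigr do rewrite big_distrr.
rewrite (convolution_assoc (fun i j k => u i * (v j * w k))).
by apply: eq_bigr => k _; rewrite big_distrl; apply: eq_bigr => i _; rewrite mulrA.
Qed.
Fact series_mul1s : left_id (series_const 1) series_mul.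
Proof.
move=> u; apply/funext => n; rewrite /series_mul big_ord_recl mul1r subn0.
by rewrite big1 ?addr0 // => i _; rewrite mul0r.
Qed.
Fact series_muls1 : right_id (series_const 1) series_mul.
Proof.
move=> u; apply/funext => n; rewrite /series_mul big_ord_recr /= subnn mulr1.
rewrite big1 ?add0r // => i _; rewrite /series_const subn_eq0 leqNgt ltn_ord.
by rewrite mulr0.
Qed.
Fact series_mulDl : left_distributive series_mul +%R.
Proof.
move=> u v w; apply/funext => n; rewrite /series_mul -[RHS]big_split /=.
by apply: eq_bigr => i _; rewrite mulrDl.
Qed.
Fact series_mulDr : right_distributive series_mul +%R.
Proof.
move=> u v w; apply/funext => n; rewrite /series_mul -[RHS]big_split /=.
by apply: eq_bigr => i _; rewrite mulrDr.
Qed.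

HB.instance Definition _ := GRing.Zmodule_isPzRing.Build (series R)
  series_mulA series_mul1s series_muls1 series_mulDl series_mulDr.

Definition tvar : series R := fun n => (n == 1)%:R.

End SeriesRing.
Arguments tvar R : clear implicits.

Section SeriesLmodule.
Variables (K : pzRingType) (V : lmodType K).
Implicit Types (c d : series K) (u v : series V).

Definition series_scale c u : series V :=
  fun n => \sum_(i < n.+1) c i *: u (n - i)%N.

Fact series_scaleA c d u :
  series_scale c (series_scale d u) = series_scale (c * d) u.
Proof.
apply/funext => n; rewrite /series_scale.
under eq_bigr do rewrite scaler_sumr.
rewrite (convolution_assoc (fun i j k => c i *: (d j *: u k))).
by apply: eq_bigr => k _; rewrite scaler_suml; apply: eq_bigr => i _; rewrite scalerA.
Qed.
Fact series_scale1 : left_id 1 series_scale.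
Proof.
move=> u; apply/funext => n; rewrite /series_scale big_ord_recl scale1r subn0.
by rewrite big1 ?addr0 // => i _; rewrite scale0r.
Qed.
Fact series_scaleDr : right_distributive series_scale +%R.
Proof.
move=> c u v; apply/funext => n; rewrite /series_scale -[RHS]big_split /=.
by apply: eq_bigr => i _; rewrite scalerDr.
Qed.
Fact series_scaleDl u : {morph series_scale^~ u : c d / c + d}.
Proof.
move=> c d; apply/funext => n; rewrite /series_scale -[RHS]big_split /=.
by apply: eq_bigr => i _; rewrite scalerDl.
Qed.

HB.instance Definition _ := GRing.Zmodule_isLmodule.Build (series K) (series V)
  series_scaleA series_scale1 series_scaleDr series_scaleDl.

(* u = 0 modulo t^p *)
Definition eq0_mod_t (p : nat) u : Prop :=
  exists v : series V, u = tvar K ^+ p *: v.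

End SeriesLmodule.

(* Exponent of the Koszul sign of the reordering x_0 x_1 ... x_(n-1) ->
   x_(s_0) x_(s_1) ..., where x_i has degree d i: the number of inversions of
   [s] between two elements of odd degree. *)
Fixpoint koszul_exp n (d : 'I_n -> int) (s : seq 'I_n) : nat :=
  if s is i :: s' then
    (count (fun j : 'I_n => [&& (j < i)%N, odd `|d i|%N & odd `|d j|%N]) s'
     + koszul_exp d s')%N
  else 0%N.

(* (i, n-i)-unshuffles, with indices starting from 0 *)
Definition unshuffle n (i : nat) (s : 'S_n) : bool :=
  [forall p : 'I_n, forall q : 'I_n,
    ((p < q)%N && ((q < i)%N || (i <= p)%N)) ==> (s p < s q)%N].

(* The two definitions below take as arguments elements a_0, ..., a_(n-1) of a
   graded ring together with their degrees d_0, ..., d_(n-1). *)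

Definition koszul_bracket (R : pzRingType) (Delta : R -> R) n
    (d : 'I_n -> int) (a : 'I_n -> R) : R :=
  \sum_(1 <= i < n.+1) \sum_(s : 'S_n | unshuffle i s)
    (-1) ^+ koszul_exp d [seq s p | p <- enum 'I_n] * (-1) ^+ (n - i) *
    (Delta (\prod_(p <- enum 'I_n | (p < i)%N) a (s p)) *
     \prod_(p <- enum 'I_n | (i <= p)%N) a (s p)).

(* The blocks of an unordered partition are multiplied in the order of
   [enum P]; by graded commutativity the Koszul sign, computed for that same
   order, makes each term independent of this choice. *)
Definition cumulant (R S : pzRingType) (f : R -> S) n
    (d : 'I_n -> int) (a : 'I_n -> R) : S :=
  \sum_(P : {set {set 'I_n}} | partition P [set: 'I_n])
    (-1) ^+ (#|P| - 1) * ((#|P| - 1)`!)%:R *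
    (-1) ^+ koszul_exp d (flatten [seq enum J | J : {set 'I_n} <- enum P]) *
    \prod_(J <- enum P) f (\prod_(i <- enum J) a i).

Section DerivedBV.
Variable K : fieldType.

(* Degree in A[[t]], where t has degree 1 - k. *)
Definition series_homog (k : int) (A : gcAlgType K) (d : int) (u : series A) :=
  forall n : nat, u n \in homog (d - n%:Z * (1 - k)).

Definition series_degree (k e : int) (A B : gcAlgType K)
    (f : series A -> series B) : Prop :=
  forall d u, series_homog k d u -> series_homog k (d + e) (f u).

(* The K[[t]]-linear extension of \sum_n t^n D_n to A[[t]]. *)
Definition series_map (A B : gcAlgType K) (D : nat -> A -> B)
    (u : series A) : series B :=
  fun n => \sum_(i < n.+1) D i (u (n - i)%N).

Record derived_BV (k : int) (A : gcAlgType K)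
    (Delta : series A -> series A) : Prop := DerivedBV {
  dBV_linear : linear Delta;
  dBV_degree : series_degree k 1 Delta;
  dBV_coef : exists D : nat -> {linear A -> A},
    [/\ Delta = series_map D,
        forall n, D n 1 = 0
      & forall n i (a : A), a \in homog i ->
          D n a \in homog (i + (1 + n%:Z * (k - 1)))];
  dBV_square : forall u, Delta (Delta u) = 0;
  dBV_bracket : forall n (d : 'I_n -> int) (a : 'I_n -> A), (2 <= n)%N ->
    (forall i, a i \in homog (d i)) ->
    eq0_mod_t (n - 1)
      (koszul_bracket Delta d (fun i => series_const (a i)))
}.

Record derived_BV_morphism (k : int) (A B : gcAlgType K)
    (DeltaA : series A -> series A) (DeltaB : series B -> series B)
    (f : series A -> series B) : Prop := DerivedBVMorphism {
  dBVm_linear : linear f;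
  dBVm_degree : series_degree k 0 f;
  dBVm_unit : f 1 = 1;
  dBVm_comm : forall u, f (DeltaA u) = DeltaB (f u);
  dBVm_cumulant : forall n (d : 'I_n -> int) (a : 'I_n -> A), (2 <= n)%N ->
    (forall i, a i \in homog (d i)) ->
    eq0_mod_t (n - 1) (cumulant f d (fun i => series_const (a i)))
}.

End DerivedBV.

(* Main.v *)
Require Import Defs.
From HB Require Import structures.
From mathcomp Require Import all_boot all_order all_algebra all_fingroup.
From mathcomp Require Import boolp zify.

Set Implicit Arguments.
Unset Strict Implicit.
Unset Printing Implicit Defensive.

Import Order.TTheory GRing.Theory Num.Theory.
Local Open Scope ring_scope.

(** Only the cumulant condition on [g \o f] needs an argument.

Cumulants are logarithms. In a commutative ring, a function [F] on finite sets
with value 1 on the empty set is the exponential of its cumulants, that is, F I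
is the sum over the set partitions of I of the products of the cumulants of the
blocks. Equivalently, for any chosen element i of I,
  F I = \sum_(i \in J \subset I) (cumulant of F on J) * F (I \ J)
[set_cumulant_recl], and this recursion determines the cumulants
[set_cumulant_unique]. It yields the composition rule [set_cumulant_comp]: the
cumulant of [psi \o F] on I is the sum, over the set partitions P of I, of the
cumulants of psi evaluated on the family of the cumulants of F on the blocks of
P.

Applied to F J = f (\prod_(i in J) a_i) and psi = g, the rule expresses a cumulant of
[g \o f] as a sum over P of cumulants of g, of arity the number of blocks,
evaluated on cumulants of f. The cumulant of f on a block J is divisible by
t^(#|J| - 1), and [cumulant_series] extends the condition on g from constants to
series: a cumulant of arity m of series divisible by t^(p_i) is divisible by
t^(m - 1 + \sum_i p_i). As the sizes of the m blocks of P add up to n, each term is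
divisible by t^(m - 1 + (n - m)) = t^(n - 1).

The Koszul signs are absorbed in a Grassmann envelope. Attach to each argument
a_i a formal variable of the same parity and square zero. The families
(F I) indexed by the sets I of variables, with F I homogeneous of the
total degree of I, form a ring under the convolution twisted by Koszul signs, and
this ring is commutative [envelope_mulC]. The product of the elements
attached to the a_i is, up to the Koszul sign, attached to the product of
the a_i; so the unsigned cumulants in the envelope compute, up to one global sign,
the signed cumulants [val_set_cumulant]. That the sign is global holds
more generally when the i-th argument is attached to a block of variables, and this is
what the composition rule requires of g. Since k is odd, t is even and multiplication by
t does not affect any sign. *)

(** * Sums over set partitions *)

Section Complements.
Variable T : finType.
Implicit Types I J L : {set T}.

Lemma disjoint_setDr I J : [disjoint J & I :\: J].
Proof. by rewrite -setI_eq0 setIDA setIC -setIDA setDv setI0. Qed.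

Lemma setU_setD I J : J \subset I -> J :|: (I :\: J) = I.
Proof.
move=> sJI; apply/setP=> x; rewrite !inE.
by case: (boolP (x \in J)) => // /(subsetP sJI).
Qed.

Lemma setU_setDl J L : [disjoint J & L] -> (J :|: L) :\: J = L.
Proof.
by move=> dJL; rewrite setDUl setDv set0U; apply/setDidPl; rewrite disjoint_sym.
Qed.

End Complements.

Section Partitions.
Variable T : finType.
Implicit Types (I J : {set T}) (P Q : {set {set T}}).

Lemma partition_sub P Q I : partition P I -> Q \subset P ->
  partition Q (cover Q).
Proof.
case/and3P=> _ trivP P0 sQP; rewrite /partition eqxx (trivIsetS sQP trivP) /=.
by apply: contra P0; apply: (subsetP sQP).
Qed.

Lemma partition_setU P Q I J : partition P I -> partition Q J ->
  [disjoint I & J] -> partition (P :|: Q) (I :|: J) /\ [disjoint P & Q].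
Proof.
move=> /and3P[/eqP cP tP P0] /and3P[/eqP cQ tQ Q0] dIJ; split.
  apply/and3P; split; last by rewrite inE (negPf P0).
    by rewrite /cover bigcup_setU -/(cover P) -/(cover Q) cP cQ.
  by apply: trivIsetU => //; rewrite cP cQ.
rewrite -setI_eq0; apply: contraNT P0 => /set0Pn[B /setIP[BP BQ]].
suff <- : B = set0 by [].
apply/eqP; rewrite -subset0 -(setIid B).
have BI : B \subset I by rewrite -cP; apply: bigcup_max BP _.
have BJ : B \subset J by rewrite -cQ; apply: bigcup_max BQ _.
by move: dIJ; rewrite -setI_eq0 => /eqP <-; apply: setISS.
Qed.

Lemma cover_setD P Q I : partition P I -> Q \subset P ->
  cover (P :\: Q) = I :\: cover Q.
Proof.
move=> pP sQP; have [/eqP <- /trivIsetP tP _] := and3P pP.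
apply/setP=> x; rewrite !inE; apply/bigcupP/andP => [[B] | [xQ /bigcupP[B BP xB]]].
  case/setDP=> BP BQ xB; split; last by apply/bigcupP; exists B.
  apply: contra BQ => /bigcupP[C CQ xC].
  suff -> : B = C by [].
  apply/eqP; apply: contraTT xC => /(tP _ _ BP (subsetP sQP _ CQ)) d.
  by rewrite (disjointFr d).
exists B => //; rewrite inE BP andbT.
by apply: contra xQ => BQ; apply/bigcupP; exists B.
Qed.

(** Splitting a partition P of I into a subset Q and the rest is the same as
    choosing the subset J of I covered by Q, a partition of J and one of the
    complement. Keeping a marked point i in J lets this one bijection serve all
    the recursions below. *)
Lemma big_partition_sub (V : nmodType) (i : T) I
    (Phi : {set {set T}} -> {set {set T}} -> V) : i \in I ->
  \sum_(P | partition P I) \sum_(Q : {set {set T}} | (Q \subset P) && (i \in cover Q))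
     Phi Q (P :\: Q)
  = \sum_(J : {set T} | (J \subset I) && (i \in J)) \sum_(Q | partition Q J)
      \sum_(P' | partition P' (I :\: J)) Phi Q P'.
Proof.
move=> iI.
pose sub Q := [&& i \in cover Q, partition Q (cover Q) & cover Q \subset I].
transitivity (\sum_(Q | sub Q) \sum_(P' | partition P' (I :\: cover Q)) Phi Q P').
  rewrite (exchange_big_dep sub) /=; last first.
    move=> P Q pP /andP[sQP iQ]; rewrite /sub iQ (partition_sub pP sQP) /=.
    apply/subsetP=> x /bigcupP[B BQ]; apply/subsetP.
    exact: partitionS pP (subsetP sQP _ BQ).
  apply: eq_bigr => Q /and3P[iQ pQ sQI].
  have dis := disjoint_setDr I (cover Q).
  rewrite (reindex_onto (fun P' => Q :|: P') (fun P => P :\: Q)) /=; last first.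
    by move=> P /and3P[_ sQP _]; apply: setU_setD.
  apply: eq_big => [P'|P' /andP[_ /eqP -> //]].
  rewrite subsetUl iQ !andbT; apply/andP/idP => [[pP /eqP eP]|pP'].
    have sP' : P' \subset Q :|: P' by apply: subsetUr.
    have := partition_sub pP sP'; rewrite -{2}eP (cover_setD pP) ?subsetUl //.
  have [pU dQ] := partition_setU pQ pP' dis; split.
    by move: pU; rewrite setU_setD.
  by apply/eqP/setU_setDl.
rewrite (partition_big (fun Q => cover Q)
  (fun J : {set T} => (J \subset I) && (i \in J))) /=; last first.
  by move=> Q /and3P[-> _ ->].
apply: eq_bigr => J /andP[sJI iJ]; apply: eq_big => [Q|Q /andP[_ /eqP -> //]].
rewrite /sub; apply/andP/idP => [[/and3P[_ pQ _] /eqP <- //]|pQ].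
by rewrite (cover_partition pQ) iJ pQ sJI eqxx.
Qed.

End Partitions.

Lemma big_disjoint_setU (R : Type) (idx : R) (op : Monoid.com_law idx)
    (T : finType) (A B : {set T}) (F : T -> R) : [disjoint A & B] ->
  \big[op/idx]_(i in A :|: B) F i
    = op (\big[op/idx]_(i in A) F i) (\big[op/idx]_(i in B) F i).
Proof.
move=> dAB; rewrite (big_setID A) /= setUK setDUl setDv set0U.
by rewrite (setDidPl _) // disjoint_sym.
Qed.

(** * Cumulants of set functions in a commutative ring *)

(** k! times the coefficient of x^k in log (1 + x), for k positive. *)
Definition cumulant_coef (R : pzRingType) (k : nat) : R :=
  (-1) ^+ (k - 1) * ((k - 1)`!)%:R.

Definition set_cumulant (T : finType) (R : comPzRingType) (F : {set T} -> R)
    (I : {set T}) : R :=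
  \sum_(P : {set {set T}} | partition P I)
    cumulant_coef R #|P| * \prod_(J in P) F J.

Lemma cumulant_coef_rec (R : pzRingType) k : (0 < k)%N ->
  cumulant_coef R k + cumulant_coef R (k - 1) *+ (k - 1) = (k == 1)%:R.
Proof.
case: k => // -[|k] _; first by rewrite /cumulant_coef subnn expr0 !mul1r mulr0n addr0.
by rewrite /cumulant_coef !subn1 /= exprS factS mulnC mulrnA -mulrnAr mulN1r mulNr addNr.
Qed.

Section SetCumulants.
Variables (T : finType) (R : comPzRingType).
Implicit Types (F u : {set T} -> R) (I J : {set T}) (P Q : {set {set T}}).

Lemma prod_setD F P Q : Q \subset P ->
  \prod_(J in P) F J = \prod_(J in Q) F J * \prod_(J in P :\: Q) F J.
Proof. by move=> sQP; rewrite (big_setID Q) /= (setIidPr sQP). Qed.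

(** A single value of F as a sum over partitions, so that it can enter the
    bijection [big_partition_sub]. *)
Lemma sum_one_block F I : I != set0 ->
  \sum_(P | partition P I) (#|P| == 1)%:R * \prod_(J in P) F J = F I.
Proof.
move=> I0; have pI : partition [set I] I.
  by rewrite /partition cover1 trivIset1 eqxx inE eq_sym I0.
rewrite (bigD1 [set I]) //= cards1 eqxx mul1r big_set1 big1 ?addr0 // => P.
case/andP=> pP nP; case: eqP; rewrite ?mul0r // => /eqP/cards1P[B eP].
case/eqP: nP; rewrite eP; congr [set _].
by rewrite -(cover_partition pP) eP cover1.
Qed.

(** Same purpose as [sum_one_block], but it also covers the empty set, whose
    only partition is empty. *)
Lemma sum_small_partition F I : F set0 = 1 ->
  \sum_(P | partition P I) (#|P| <= 1)%:R * \prod_(J in P) F J = F I.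
Proof.
move=> F0; have [-> | I0] := eqVneq I set0.
  under eq_bigl do rewrite partition_set0.
  by rewrite big_pred1_eq cards0 mul1r big_set0.
rewrite -[RHS]sum_one_block //; apply: eq_bigr => P pP; congr (_%:R * _).
suff : (0 < #|P|)%N by case: #|P| => [|[]].
rewrite card_gt0; apply: contraNneq I0 => P0.
by rewrite -(cover_partition pP) P0 /cover big_set0.
Qed.

(** The derivative of F = exp U is U' * F, where the derivation keeps the sets
    that contain i. After the bijection [big_partition_sub], each partition P of
    I is counted once as the whole of Q, and once for every block not containing
    i as the block omitted from Q; the coefficients cancel by
    [cumulant_coef_rec] unless P has a single block. *)
Lemma set_cumulant_recl F I i : F set0 = 1 -> i \in I ->
  F I = \sum_(J : {set T} | (J \subset I) && (i \in J)) set_cumulant F J * F (I :\: J).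
Proof.
move=> F0 iI.
transitivity (\sum_(J : {set T} | (J \subset I) && (i \in J)) \sum_(Q | partition Q J)
   \sum_(P | partition P (I :\: J)) (cumulant_coef R #|Q| * (#|P| <= 1)%:R) *
      (\prod_(L in Q) F L * \prod_(L in P) F L)); last first.
  apply: eq_bigr => J _; rewrite big_distrl; apply: eq_bigr => Q _ /=.
  rewrite -(sum_small_partition (I :\: J) F0) big_distrr; apply: eq_bigr => P _ /=.
  by rewrite mulrACA.
rewrite -(big_partition_sub
  (fun Q P => (cumulant_coef R #|Q| * (#|P| <= 1)%:R) *
      (\prod_(L in Q) F L * \prod_(L in P) F L)) iI).
rewrite -(@sum_one_block F); last by apply/set0Pn; exists i.
apply: eq_bigr => P pP; set c := fun Q P' => cumulant_coef R #|Q| * (#|P'| <= 1)%:R.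
transitivity (\sum_(Q : {set {set T}} | (Q \subset P) && (i \in cover Q))
  c Q (P :\: Q) * \prod_(L in P) F L); last first.
  by apply: eq_bigr => Q /andP[sQP _]; rewrite -prod_setD.
rewrite -big_distrl /=; congr (_ * _).
have iP : i \in cover P by rewrite (cover_partition pP).
have tP := partition_trivIset pP.
pose b := pblock P i; have bP : b \in P := pblock_mem iP.
rewrite -cumulant_coef_rec; last by apply/card_gt0P; exists b.
(* The Q such that P \ Q has at most one block: P itself, and P minus a block
   different from the block b of i. *)
transitivity (\sum_(Q in P |: [set P :\ B | B in P :\ b]) cumulant_coef R #|Q|).
  rewrite big_setU1 /=; last first.
    apply/imsetP=> -[B]; rewrite !inE => /andP[_ BP] /setP/(_ B).
    by rewrite !inE eqxx BP.
  congr (_ + _); rewrite big_imset /=; last first.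
    move=> B C; rewrite !inE => /andP[_ BP] /andP[_ CP] /setP/(_ B).
    by rewrite !inE eqxx BP andbT /=; case: eqP.
  rewrite (eq_bigr (fun _ => cumulant_coef R (#|P| - 1))); last first.
    by move=> B; rewrite !inE => /andP[_ BP]; rewrite (cardsD1 B P) BP add1n subn1.
  by rewrite sumr_const (cardsD1 b P) bP add1n subn1.
rewrite big_mkcond [RHS]big_mkcond; apply: eq_bigr => Q _.
have -> : (Q \in P |: [set P :\ B | B in P :\ b])
   = (Q \subset P) && (i \in cover Q) && (#|P :\: Q| <= 1)%N; last first.
  by rewrite /c; case: (_ && (i \in _)); case: leqP; rewrite ?mulr1 ?mulr0.
apply/setU1P/idP => [[->|/imsetP[B]]|].
- by rewrite subxx iP setDv cards0.
- rewrite !inE => /andP[nB BP] ->; rewrite subsetDl coverD1 // inE iP andbT.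
  rewrite setDDr setDv set0U /=; apply/andP; split; last first.
    by apply: leq_trans (subset_leq_card (subsetIr _ _)) _; rewrite cards1.
  by apply: contra nB => iB; rewrite eq_sym; apply/eqP/def_pblock.
case/andP=> /andP[sQP iQ]; rewrite leq_eqVlt ltnS leqn0 cards_eq0 setD_eq0.
case/orP=> [/cards1P[B eB]|sPQ]; last by left; apply/eqP; rewrite eqEsubset sQP.
have /setDP[BP BQ] : B \in P :\: Q by rewrite eB inE.
right; apply/imsetP; exists B.
  rewrite !inE BP andbT; apply: contraNneq BQ => ->.
  have /bigcupP[C CQ iC] := iQ.
  by rewrite /b (def_pblock tP (subsetP sQP _ CQ) iC).
by rewrite -eB setDDr setDv set0U (setIidPr sQP).
Qed.

(** In the recursion for I the term J = I is u I itself, as F set0 = 1, and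
    every other u J occurs on a smaller set. *)
Lemma set_cumulant_unique F u : F set0 = 1 ->
  (forall I, I != set0 -> exists2 i, i \in I &
     F I = \sum_(J : {set T} | (J \subset I) && (i \in J)) u J * F (I :\: J)) ->
  forall I, I != set0 -> u I = set_cumulant F I.
Proof.
move=> F0 urec I; have [n] := ubnP #|I|; elim: n I => // n IHn I; rewrite ltnS => leI I0.
have [i iI eF] := urec I I0; move: eF; rewrite {1}(set_cumulant_recl F0 iI).
rewrite (bigD1 I) ?subxx ?iI //= [RHS](bigD1 I) ?subxx ?iI //= setDv F0 !mulr1.
rewrite [X in _ = _ + X](_ : _ = \sum_(J : {set T} | (J \subset I) && (i \in J) && (J != I))
   set_cumulant F J * F (I :\: J)); first by move/addIr.
apply: eq_bigr => J /andP[/andP[sJI iJ] nJ]; rewrite IHn //.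
  by apply: leq_trans (proper_card _) leI; rewrite properEneq nJ.
by apply/set0Pn; exists i.
Qed.

(** The exponential formula, by induction on the cardinal of I from the
    recursion: J is the block of the marked point. *)
Lemma sum_prod_set_cumulant F I : F set0 = 1 ->
  F I = \sum_(P | partition P I) \prod_(J in P) set_cumulant F J.
Proof.
move=> F0; have [n] := ubnP #|I|; elim: n I => // n IHn I; rewrite ltnS => leI.
have [-> | /set0Pn[i iI]] := eqVneq I set0.
  under eq_bigl do rewrite partition_set0.
  by rewrite big_pred1_eq big_set0.
rewrite (set_cumulant_recl F0 iI).
pose y (P : {set {set T}}) := \prod_(J in P) set_cumulant F J.
transitivity (\sum_(J : {set T} | (J \subset I) && (i \in J)) \sum_(Q | partition Q J)
   \sum_(P | partition P (I :\: J)) (#|Q| == 1)%:R * (y Q * y P)).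
  apply: eq_bigr => J /andP[sJI iJ].
  rewrite -{1}(@sum_one_block (set_cumulant F)); last by apply/set0Pn; exists i.
  rewrite IHn; last first.
    apply: leq_trans (proper_card _) leI; rewrite properE subsetDl.
    by apply/subsetPn; exists i; rewrite ?inE ?iJ.
  rewrite big_distrl; apply: eq_bigr => Q _ /=.
  by rewrite big_distrr; apply: eq_bigr => P _; rewrite mulrA.
rewrite -(big_partition_sub (fun Q P => (#|Q| == 1)%:R * (y Q * y P)) iI).
apply: eq_bigr => P pP.
transitivity (\sum_(Q : {set {set T}} | (Q \subset P) && (i \in cover Q))
  (#|Q| == 1)%:R * y P).
  by apply: eq_bigr => Q /andP[sQP _]; rewrite -prod_setD.
rewrite -big_distrl /= -[RHS]mul1r; congr (_ * _).
have iP : i \in cover P by rewrite (cover_partition pP).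
pose b := pblock P i; have bP : b \in P := pblock_mem iP.
rewrite (bigD1 [set b]) /=; last by rewrite sub1set bP cover1 mem_pblock.
rewrite cards1 eqxx big1 ?addr0 // => Q /andP[/andP[sQP iQ] nQ].
case: eqP => // /eqP/cards1P[B eQ]; case/eqP: nQ; rewrite eQ; congr [set _].
rewrite /b (def_pblock (partition_trivIset pP) (B := B)) //.
  by apply: (subsetP sQP); rewrite eQ inE.
by move: iQ; rewrite eQ cover1.
Qed.

End SetCumulants.

Lemma set_cumulant_imset (T T' : finType) (R : comPzRingType) (h : T -> T')
    (F : {set T'} -> R) (I : {set T}) : injective h ->
  set_cumulant F (h @: I) = set_cumulant (fun J : {set T} => F (h @: J)) I.
Proof.
move=> injh; pose hh (P : {set {set T}}) := [set h @: (B : {set T}) | B in P].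
have injI : injective (fun B : {set T} => h @: B) := imset_inj injh.
have injhh : injective hh := imset_inj injI.
pose gg (P : {set {set T'}}) := [set h @^-1: (B : {set T'}) | B in P].
rewrite /set_cumulant (reindex_onto hh gg) /=; last first.
  move=> P pP; rewrite /hh /gg -imset_comp -[RHS]imset_id; apply: eq_in_imset => B BP /=.
  have /subsetP sB := partitionS pP BP.
  apply/setP=> x; apply/imsetP/idP => [[z]|xB]; first by rewrite inE => ? ->.
  by have /imsetP[z _ ez] := sB _ xB; exists z; rewrite ?inE -?ez.
apply: eq_big => [P|P /andP[_ _]].
  rewrite /hh imset_partition // -[RHS]andbT; congr (_ && _); apply/eqP.
  rewrite /gg -imset_comp -[RHS]imset_id; apply: eq_imset => B /=.
  apply/setP=> x; rewrite inE; apply/imsetP/idP => [[z zB /injh ->//]|xB].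
  by exists x.
rewrite /hh card_imset //; congr (_ * _); rewrite big_imset //=.
by move=> x y _ _; apply: injI.
Qed.

(** By [set_cumulant_unique] it suffices that the right-hand side satisfies the
    recursion for psi \o F. Expand psi (F I) as a sum over the partitions P of
    I, apply to each P, as a set of blocks, the recursion of the cumulants of
    psi with the block of i marked, and regroup by [big_partition_sub]. *)
Theorem set_cumulant_comp (T : finType) (R S : comPzRingType) (F : {set T} -> R)
    (psi : R -> S) (I : {set T}) :
  zmod_morphism psi -> F set0 = 1 -> psi 1 = 1 -> I != set0 ->
  set_cumulant (psi \o F) I =
  \sum_(P | partition P I)
    set_cumulant (fun Q : {set {set T}} => psi (\prod_(J in Q) set_cumulant F J)) P.
Proof.
move=> psiB F0 psi1 I0.
pose psi_add : {additive R -> S} := HB.pack psi (GRing.isZmodMorphism.Build R S psi psiB).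
set y := set_cumulant F.
pose G (Q : {set {set T}}) := psi (\prod_(J in Q) y J).
have G0 : G set0 = 1 by rewrite /G big_set0.
have psiF J : psi (F J) = \sum_(P | partition P J) G P.
  by rewrite (sum_prod_set_cumulant _ F0) -[psi]/(psi_add : R -> S) raddf_sum.
symmetry; move: I I0; apply: set_cumulant_unique => [|I /set0Pn[i iI]].
  by rewrite /= F0.
exists i => //=; rewrite psiF.
under [RHS]eq_bigr => J do rewrite big_distrl /=.
transitivity (\sum_(J : {set T} | (J \subset I) && (i \in J)) \sum_(Q | partition Q J)
   \sum_(P | partition P (I :\: J)) set_cumulant G Q * G P); last first.
  by apply: eq_bigr => J _; apply: eq_bigr => Q _; rewrite psiF big_distrr.
rewrite -(big_partition_sub (fun Q P => set_cumulant G Q * G P) iI).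
apply: eq_bigr => P pP.
have iP : i \in cover P by rewrite (cover_partition pP).
rewrite (set_cumulant_recl G0 (pblock_mem iP)); apply: eq_bigl => Q.
have tP := partition_trivIset pP.
case: (boolP (Q \subset P)) => //= sQP; apply/idP/bigcupP => [bQ|[B BQ iB]].
  by exists (pblock P i); rewrite ?mem_pblock.
by rewrite (def_pblock tP (subsetP sQP _ BQ) iB).
Qed.

(** * Koszul signs as sums over pairs *)

Section PairSum.
Local Open Scope nat_scope.

(** The sum of c i j over the pairs of entries with i before j in s. The Koszul
    exponent is the case where c detects odd inversions; general weights occur
    when the letters are themselves blocks of letters. *)
Fixpoint pair_sum (T : Type) (c : T -> T -> nat) (s : seq T) : nat :=
  if s is i :: s' then \sum_(j <- s') c i j + pair_sum c s' else 0.

Lemma pair_sum_cat (T : Type) (c : T -> T -> nat) s t :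
  pair_sum c (s ++ t) =
  pair_sum c s + pair_sum c t + \sum_(i <- s) \sum_(j <- t) c i j.
Proof.
elim: s => [|i s IHs] /=; first by rewrite big_nil addn0.
by rewrite IHs big_cat big_cons /=; lia.
Qed.

Lemma pair_sum_flatten (U T : Type) (c : T -> T -> nat) (g : U -> seq T) ss :
  pair_sum c (flatten [seq g q | q <- ss]) =
  \sum_(q <- ss) pair_sum c (g q)
    + pair_sum (fun q r => \sum_(i <- g q) \sum_(j <- g r) c i j) ss.
Proof.
elim: ss => [|q ss IHs] /=; first by rewrite big_nil.
rewrite pair_sum_cat IHs big_cons.
have -> : \sum_(i <- g q) \sum_(j <- flatten [seq g q | q <- ss]) c i j
  = \sum_(r <- ss) \sum_(i <- g q) \sum_(j <- g r) c i j.
  by rewrite [RHS]exchange_big; apply: eq_bigr => i _; rewrite big_flatten big_map.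
by lia.
Qed.

(** Twice the sum, plus the diagonal terms, is the sum over all ordered pairs,
    which does not see the order of s. *)
Lemma pair_sum_perm (T : eqType) (h : T -> T -> nat) (s t : seq T) :
  (forall i j, h i j = h j i) -> perm_eq s t -> pair_sum h s = pair_sum h t.
Proof.
move=> hC st; have square r : (pair_sum h r).*2 + \sum_(i <- r) h i i
    = \sum_(i <- r) \sum_(j <- r) h i j.
  elim: r => [|i r IHr] /=; first by rewrite !big_nil.
  rewrite !big_cons.
  rewrite [X in _ = _ + X](eq_bigr (fun j => h i j + \sum_(l <- r) h j l)) => [|j _].
    by rewrite big_split /= -IHr; lia.
  by rewrite big_cons hC.
apply: double_inj; apply: (@addIn (\sum_(i <- s) h i i)).
rewrite square [in RHS](perm_big _ st) square (perm_big _ st).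
by apply: eq_bigr => i _; apply: perm_big.
Qed.

Lemma eq_odd_pair_sum (T : eqType) (b c : T -> T -> nat) (s : seq T) : uniq s ->
  {in s &, forall i j, i != j -> odd (b i j) = odd (c i j)} ->
  odd (pair_sum b s) = odd (pair_sum c s).
Proof.
elim: s => //= i s IHs /andP[iNs us] bc; rewrite !oddD IHs //; last first.
  by move=> j l js ls; apply: bc; rewrite inE ?js ?ls orbT.
congr (_ (+) _); rewrite -![odd (\sum_(_ <- _) _)]/(odd _).
rewrite !big_seq; elim/big_rec2: _ => // j x y js; rewrite !oddD => ->.
by rewrite bc ?inE ?js ?eqxx ?orbT //; apply: contraNneq iNs => ->.
Qed.

Lemma pair_sum_split (T : Type) (b c : T -> T -> nat) (s : seq T) :
  pair_sum (fun i j => b i j + c i j) s = pair_sum b s + pair_sum c s.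
Proof. by elim: s => //= i s ->; rewrite big_split /=; lia. Qed.

End PairSum.

Section Signs.
Variables (n : nat) (d : 'I_n -> int).
Implicit Types J L : {set 'I_n}.
Local Open Scope nat_scope.

Definition koszul_inversion (i j : 'I_n) : nat := [&& j < i, odd `|d i|%N & odd `|d j|%N].

Lemma koszul_expE s : koszul_exp d s = pair_sum koszul_inversion s.
Proof.
elim: s => //= i s ->; congr addn; rewrite -sum1_count big_mkcond.
by apply: eq_bigr => j _; rewrite /koszul_inversion; case: ifP.
Qed.

(** The exponent of the sign that merges the increasing products over J and over
    L into the increasing product over their union. *)
Definition crossing (J L : {set 'I_n}) : nat :=
  \sum_(i in J) \sum_(j in L) koszul_inversion i j.

Definition total_degree (J : {set 'I_n}) : int := (\sum_(i in J) d i)%R.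

Lemma cross0l L : crossing set0 L = 0.
Proof. by rewrite /crossing big_set0. Qed.

Lemma cross0r J : crossing J set0 = 0.
Proof. by rewrite /crossing; under eq_bigr do rewrite big_set0; rewrite big1. Qed.

Lemma crossUl (J J' L : {set 'I_n}) : [disjoint J & J'] ->
  crossing (J :|: J') L = crossing J L + crossing J' L.
Proof. by move=> dJ; rewrite /crossing big_disjoint_setU //. Qed.

Lemma crossUr (J L L' : {set 'I_n}) : [disjoint L & L'] ->
  crossing J (L :|: L') = crossing J L + crossing J L'.
Proof.
move=> dL; rewrite /crossing -big_split; apply: eq_bigr => i _ /=.
by rewrite big_disjoint_setU //.
Qed.

Lemma odd_abszD (a b : int) : odd `|(a + b)%R|%N = odd `|a|%N (+) odd `|b|%N.
Proof.
have oddE m : odd m = (m %% 2 == 1)%N by lia.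
by rewrite !oddE; lia.
Qed.

Lemma odd_absz_sum (I : Type) (r : seq I) (P : pred I) (F : I -> int) :
  odd `|(\sum_(i <- r | P i) F i)%R|%N = odd (\sum_(i <- r | P i) odd `|F i|%N).
Proof.
by elim/big_rec2: _ => // i x y _; rewrite odd_abszD oddD oddb => <-.
Qed.

(** Each pair of odd elements, one in J and the other in L, is an inversion in
    exactly one of the two orders. *)
Lemma odd_cross_sym J L : [disjoint J & L] ->
  odd (crossing J L + crossing L J) = odd `|total_degree J|%N && odd `|total_degree L|%N.
Proof.
move=> dJL; rewrite /total_degree !odd_absz_sum -oddM big_distrlr /=.
rewrite {2}/crossing exchange_big /= /crossing -big_split /=; congr odd.
apply: eq_bigr => i iJ; rewrite -big_split; apply: eq_bigr => j jL /=.
have ij : val i != val j.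
  by apply: contraTneq iJ => /val_inj->; rewrite (disjointFl dJL jL).
rewrite /koszul_inversion; case: (ltngtP i j) ij => // _ _; case: odd; case: odd; rewrite //=.
Qed.

End Signs.

Lemma eq_sign (R : pzRingType) a b :
  odd a = odd b -> (-1) ^+ a = (-1) ^+ b :> R.
Proof. by move=> ab; rewrite -signr_odd ab signr_odd. Qed.

(** * The Grassmann envelope of a graded commutative ring *)

(** Only the multiplicative and additive behaviour of homogeneous elements is
    recorded: K[[t]]-algebras such as A[[t]] are not the direct sum of their
    homogeneous components. *)
Record gradedRing := GradedRing {
  gr_ring :> pzRingType;
  gr_homog : int -> gr_ring -> Prop;
  gr_homog0 : forall i, gr_homog i 0;
  gr_homogB : forall i a b, gr_homog i a -> gr_homog i b -> gr_homog i (a - b);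
  gr_homog1 : gr_homog 0 1;
  gr_homogM : forall i j a b,
    gr_homog i a -> gr_homog j b -> gr_homog (i + j) (a * b);
  gr_homogC : forall i j a b, gr_homog i a -> gr_homog j b ->
    b * a = (-1) ^+ (odd `|i|%N && odd `|j|%N) * (a * b)
}.

Section GradedRing.
Variable S : gradedRing.

Lemma gr_homogN i (a : S) : gr_homog i a -> gr_homog i (- a).
Proof. by move=> ai; rewrite -sub0r; apply: gr_homogB => //; apply: gr_homog0. Qed.

Lemma gr_homogD i (a b : S) : gr_homog i a -> gr_homog i b -> gr_homog i (a + b).
Proof. by move=> ai bi; rewrite -[b]opprK; apply: gr_homogB => //; apply: gr_homogN. Qed.

Lemma gr_homog_sum i (I : Type) (r : seq I) (P : pred I) (F : I -> S) :
  (forall j, P j -> gr_homog i (F j)) -> gr_homog i (\sum_(j <- r | P j) F j).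
Proof. by move=> Fi; elim/big_ind: _ => //; [apply: gr_homog0 | apply: gr_homogD]. Qed.

Lemma gr_homog_sign i m (a : S) : gr_homog i a -> gr_homog i ((-1) ^+ m * a).
Proof. by move=> ai; rewrite -signr_odd mulr_sign; case: odd => //; apply: gr_homogN. Qed.

End GradedRing.

(** The family (F I) stands for \sum_I F I e_I, where e_I is the decreasing
    product of the formal variables e_i, i in I, and e_i has the parity of d i
    and square zero. Moving G L, of the parity of e_L, across e_J and sorting
    e_J e_L produces the sign of exponent [crossing J L]. *)
Definition twisted (S : gradedRing) n (d : 'I_n -> int) : Type :=
  {ffun {set 'I_n} -> S}.

HB.instance Definition _ (S : gradedRing) n (d : 'I_n -> int) :=
  GRing.Zmodule.copy (twisted S d) {ffun {set 'I_n} -> S}.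

Section Twisted.
Variables (S : gradedRing) (n : nat) (d : 'I_n -> int).
Implicit Types F G H : {ffun {set 'I_n} -> S}.
Implicit Types I J L : {set 'I_n}.

Definition twisted_mul F G : {ffun {set 'I_n} -> S} :=
  [ffun I : {set 'I_n} => \sum_(J : {set 'I_n} | J \subset I)
     (-1) ^+ crossing d J (I :\: J) * (F J * G (I :\: J))].

Definition delta J (a : S) : {ffun {set 'I_n} -> S} :=
  [ffun I : {set 'I_n} => if I == J then a else 0].

(** Both sides are sums over the ordered triples of disjoint sets of union I;
    the exponents agree because [crossing] is additive in each argument. *)
Fact twisted_mulA : associative twisted_mul.
Proof.
move=> F G H; apply/ffunP=> I; rewrite !ffunE.
transitivity (\sum_(J : {set 'I_n} | J \subset I) \sum_(L : {set 'I_n} | L \subset I :\: J)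
  (-1) ^+ (crossing d J L + crossing d (J :|: L) (I :\: (J :|: L)))
     * (F J * G L * H (I :\: (J :|: L)))).
  apply: eq_bigr => J sJI; rewrite ffunE !big_distrr; apply: eq_bigr => L sL /=.
  rewrite setDDl mulrA mulrA -(mulrA _ (F J)) (commr_sign (F J)) !mulrA -exprD.
  congr (_ ^+ _ * _ * _ * _); have dJL : [disjoint J & L].
    by apply: disjointWr sL _; apply: disjoint_setDr.
  rewrite (crossUl d _ dJL) -{1}(setU_setD sL) crossUr ?disjoint_setDr //.
  by rewrite setDDl addnA.
transitivity (\sum_(M : {set 'I_n} | M \subset I) \sum_(J : {set 'I_n} | J \subset M)
  (-1) ^+ (crossing d J (M :\: J) + crossing d M (I :\: M))
     * (F J * G (M :\: J) * H (I :\: M))); last first.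
  apply: eq_bigr => M _; rewrite ffunE big_distrl big_distrr; apply: eq_bigr => J _ /=.
  by rewrite !mulrA -exprD addnC.
rewrite [RHS](exchange_big_dep (fun J => J \subset I)) /=; last first.
  by move=> M J sMI sJM; apply: subset_trans sMI.
apply: eq_bigr => J sJI; symmetry.
rewrite (reindex_onto (fun L => J :|: L) (fun M => M :\: J)) /=; last first.
  by move=> M /andP[_ sJM]; rewrite setU_setD.
apply: eq_big => [L|L /andP[_ /eqP -> //]].
rewrite subUset sJI subsetUl andbT /=; apply/andP/idP => [[sLI /eqP <-]|sL].
  by apply: setSD; rewrite subUset sJI.
split; first by apply: subset_trans sL _; apply: subsetDl.
apply/eqP/setU_setDl; apply: disjointWr sL _; apply: disjoint_setDr.
Qed.

Fact twisted_mul1l : left_id (delta set0 1) twisted_mul.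
Proof.
move=> F; apply/ffunP=> I; rewrite ffunE (bigD1 set0) ?sub0set //=.
rewrite cross0l ffunE eqxx !mul1r setD0 big1 ?addr0 // => J /andP[_ /negPf nJ].
by rewrite ffunE nJ mul0r mulr0.
Qed.

Fact twisted_mul1r : right_id (delta set0 1) twisted_mul.
Proof.
move=> F; apply/ffunP=> I; rewrite ffunE (bigD1 I) //=.
rewrite setDv cross0r ffunE eqxx mul1r mulr1 big1 ?addr0 // => J /andP[sJI nJ].
rewrite ffunE setD_eq0 ifN ?mulr0 //; apply: contra nJ => sIJ.
by rewrite eqEsubset sJI.
Qed.

Fact twisted_mulDl : left_distributive twisted_mul +%R.
Proof.
move=> F G H; apply/ffunP=> I; rewrite !ffunE -big_split; apply: eq_bigr => J _.
by rewrite /= !ffunE mulrDl mulrDr.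
Qed.

Fact twisted_mulDr : right_distributive twisted_mul +%R.
Proof.
move=> F G H; apply/ffunP=> I; rewrite !ffunE -big_split; apply: eq_bigr => J _.
by rewrite /= !ffunE !mulrDr.
Qed.

HB.instance Definition _ := GRing.Zmodule_isPzRing.Build (twisted S d)
  twisted_mulA twisted_mul1l twisted_mul1r twisted_mulDl twisted_mulDr.

Lemma twisted_mulE (F G : twisted S d) : F * G = twisted_mul F G.
Proof. by []. Qed.

Lemma twisted_oneE : 1 = delta set0 1 :> twisted S d.
Proof. by []. Qed.

Lemma delta_mul J L a b : [disjoint J & L] ->
  (delta J a : twisted S d) * (delta L b : twisted S d)
    = delta (J :|: L) ((-1) ^+ crossing d J L * (a * b)).
Proof.
move=> dJL; rewrite twisted_mulE; apply/ffunP=> I; rewrite !ffunE.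
have [->|nI] := eqVneq.
  rewrite (bigD1 J) ?subsetUl //= !ffunE eqxx setU_setDl // eqxx big1 ?addr0 // => M.
  by case/andP=> _ /negPf nM; rewrite ffunE nM mul0r mulr0.
rewrite big1 // => M sMI; rewrite !ffunE; case: eqP => [eM|]; last by rewrite mul0r mulr0.
case: eqP => [eL|]; last by rewrite !mulr0.
by case/eqP: nI; rewrite -(setU_setD sMI) eL eM.
Qed.

Definition homogeneous_pred : {pred twisted S d} :=
  fun F => `[< forall I, gr_homog (total_degree d I) (F I) >].

Fact homogeneous_subring : subring_closed homogeneous_pred.
Proof.
split=> [|F G /asboolP hF /asboolP hG|F G /asboolP hF /asboolP hG]; apply/asboolP=> I.
- rewrite ffunE; case: eqP => [->|_]; last exact: gr_homog0.
  by rewrite /total_degree big_set0; apply: gr_homog1.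
- by rewrite !ffunE; apply: gr_homogB.
- rewrite twisted_mulE ffunE; apply: gr_homog_sum => J sJI; apply: gr_homog_sign.
  have -> : total_degree d I = total_degree d J + total_degree d (I :\: J).
    by rewrite -{1}(setU_setD sJI) /total_degree big_disjoint_setU ?disjoint_setDr.
  exact: gr_homogM.
Qed.

(** The coefficient of e_I has the degree of e_I, so all elements are even. This
    is what makes the product commutative. *)
Record envelope := Envelope { env_val : twisted S d; _ : env_val \in homogeneous_pred }.

HB.instance Definition _ := [isSub for env_val].
HB.instance Definition _ := [Choice of envelope by <:].
HB.instance Definition _ := GRing.SubChoice_isSubPzRing.Build
  (twisted S d) homogeneous_pred envelope homogeneous_subring.

Lemma envelopeP (x : envelope) I : gr_homog (total_degree d I) (val x I).
Proof. by case: x => F /= /asboolP. Qed.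

Fact envelope_mulC : commutative (@GRing.mul envelope).
Proof.
move=> x y; apply: val_inj; rewrite !rmorphM /= !twisted_mulE.
apply/ffunP=> I; rewrite !ffunE [RHS](reindex_onto (fun J => I :\: J) (fun J => I :\: J)) /=.
  apply: eq_big => [J|J sJI].
    rewrite subsetDl setDDr setDv set0U; apply/idP/eqP => [/setIidPr //|<-].
    exact: subsetIl.
  have IDJ : I :\: (I :\: J) = J by rewrite setDDr setDv set0U; apply/setIidPr.
  rewrite IDJ (gr_homogC (envelopeP x J) (envelopeP y (I :\: J))).
  rewrite -odd_cross_sym ?disjoint_setDr // signr_odd mulrA -exprD.
  by congr (_ * _); apply: eq_sign; rewrite !oddD addbCA addbb addbF.
by move=> J sJI; rewrite setDDr setDv set0U; apply/setIidPr.
Qed.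

HB.instance Definition _ := GRing.PzRing_hasCommutativeMul.Build envelope envelope_mulC.

End Twisted.

(** * Signed cumulants as cumulants in the envelope *)

Lemma disjoint_bigcup_seq (T : finType) (U : eqType) (J : {set T})
    (L : U -> {set T}) (s : seq U) :
  {in s, forall i, [disjoint J & L i]} -> [disjoint J & \bigcup_(i <- s) L i].
Proof.
move=> dL; rewrite big_seq; elim/big_ind: _ => [|A B|i /dL //].
  by rewrite -setI_eq0 setI0.
by rewrite -!setI_eq0 setIUr setU_eq0 => -> ->.
Qed.

Section Delta.
Variables (S : gradedRing) (n : nat) (d : 'I_n -> int).
Implicit Types J L : {set 'I_n}.

Lemma homogeneous_delta J (a : S) :
  gr_homog (total_degree d J) a -> (delta J a : twisted S d) \in @homogeneous_pred S n d.
Proof.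
by move=> ha; apply/asboolP=> I; rewrite ffunE; case: eqP => [->//|_]; apply: gr_homog0.
Qed.

Lemma delta_sum J (I : Type) (r : seq I) (P : pred I) (F : I -> S) :
  delta J (\sum_(i <- r | P i) F i) = \sum_(i <- r | P i) (delta J (F i) : twisted S d).
Proof.
apply/ffunP=> M; rewrite ffunE sum_ffunE; under [RHS]eq_bigr do rewrite ffunE.
by case: (M == J) => //; rewrite big1.
Qed.

Lemma delta_coef J (c : nat) k (a : S) :
  delta J ((-1) ^+ k * c%:R * a) = (-1) ^+ k * c%:R * (delta J a : twisted S d).
Proof.
have natE : forall b, delta J (c%:R * b) = c%:R * (delta J b : twisted S d).
  move=> b; rewrite !mulr_natl; elim: c => [|c IHc].
    by rewrite !mulr0n; apply/ffunP=> M; rewrite !ffunE; case: ifP.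
  by rewrite !mulrS -IHc; apply/ffunP=> M; rewrite !ffunE; case: ifP; rewrite ?addr0.
rewrite -!mulrA -natE -signr_odd -[in RHS]signr_odd !mulr_sign; case: odd => //.
by apply/ffunP=> M; rewrite !ffunE; case: ifP; rewrite ?oppr0.
Qed.

Lemma cross_bigcup (T : eqType) J (L : T -> {set 'I_n}) (s : seq T) : uniq s ->
  {in s &, forall i j, i != j -> [disjoint L i & L j]} ->
  crossing d J (\bigcup_(i <- s) L i) = (\sum_(i <- s) crossing d J (L i))%N.
Proof.
elim: s => [|i s IHs] /=; first by rewrite !big_nil cross0r.
case/andP=> iNs us dL; rewrite !big_cons crossUr.
  by rewrite IHs // => j l js ls; apply: dL; rewrite inE ?js ?ls orbT.
apply: disjoint_bigcup_seq => j js; apply: dL; rewrite ?inE ?eqxx ?js ?orbT //.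
by apply: contraNneq iNs => ->.
Qed.

Lemma cross_bigcupl (T : eqType) K (L : T -> {set 'I_n}) (s : seq T) : uniq s ->
  {in s &, forall i j, i != j -> [disjoint L i & L j]} ->
  crossing d (\bigcup_(i <- s) L i) K = (\sum_(i <- s) crossing d (L i) K)%N.
Proof.
elim: s => [|i s IHs] /=; first by rewrite !big_nil cross0l.
case/andP=> iNs us dL; rewrite !big_cons crossUl.
  by rewrite IHs // => j l js ls; apply: dL; rewrite inE ?js ?ls orbT.
apply: disjoint_bigcup_seq => j js; apply: dL; rewrite ?inE ?eqxx ?js ?orbT //.
by apply: contraNneq iNs => ->.
Qed.

Lemma prod_delta (T : eqType) (L : T -> {set 'I_n}) (a : T -> S) (s : seq T) :
  uniq s -> {in s &, forall i j, i != j -> [disjoint L i & L j]} ->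
  \prod_(i <- s) (delta (L i) (a i) : twisted S d)
  = delta (\bigcup_(i <- s) L i)
      ((-1) ^+ pair_sum (fun i j => crossing d (L i) (L j)) s * \prod_(i <- s) a i).
Proof.
elim: s => [|i s IHs] /=.
  by rewrite !big_nil mulr1.
case/andP=> iNs us dL; have dLs : {in s &, forall i j, i != j -> [disjoint L i & L j]}.
  by move=> j l js ls; apply: dL; rewrite inE ?js ?ls orbT.
rewrite !big_cons IHs // delta_mul.
  by rewrite cross_bigcup // exprD !mulrA -(mulrA _ (a i)) commr_sign !mulrA.
apply: disjoint_bigcup_seq => j js; apply: dL; rewrite ?inE ?eqxx ?js ?orbT //.
by apply: contraNneq iNs => ->.
Qed.

End Delta.

Lemma prod_sign (R : pzRingType) (T : Type) (s : seq T) (e : T -> nat) (a : T -> R) :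
  \prod_(i <- s) ((-1) ^+ e i * a i)
    = (-1) ^+ (\sum_(i <- s) e i)%N * \prod_(i <- s) a i.
Proof.
elim: s => [|i s IHs]; first by rewrite !big_nil mulr1.
by rewrite !big_cons IHs exprD !mulrA -(mulrA _ (a i)) commr_sign !mulrA.
Qed.

Section EnvelopeMap.
Variables (R S : gradedRing) (phi : R -> S).
Hypotheses (phiB : zmod_morphism phi)
  (phi_homog : forall i a, gr_homog i a -> gr_homog i (phi a)).
Variables (n : nat) (d : 'I_n -> int).

Fact zmod_morphism0 : phi 0 = 0.
Proof. by rewrite -(subrr 0) phiB subrr. Qed.

Fact zmod_morphism_sign k a : phi ((-1) ^+ k * a) = (-1) ^+ k * phi a.
Proof.
rewrite -signr_odd mulr_sign -[in RHS]signr_odd mulr_sign; case: odd => //.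
by rewrite -sub0r phiB zmod_morphism0 sub0r.
Qed.

Definition twisted_map (F : twisted R d) : twisted S d :=
  [ffun I : {set 'I_n} => phi (F I)].

Fact twisted_map_homogeneous (x : envelope R d) :
  twisted_map (val x) \in @homogeneous_pred S n d.
Proof. by apply/asboolP=> I; rewrite ffunE; apply/phi_homog/envelopeP. Qed.

Definition envelope_map (x : envelope R d) : envelope S d :=
  Envelope (twisted_map_homogeneous x).

Fact envelope_map_zmod_morphism : zmod_morphism envelope_map.
Proof.
move=> x y; apply: val_inj; rewrite rmorphB /=; apply/ffunP=> I.
by rewrite !ffunE phiB.
Qed.

Lemma envelope_map1 : phi 1 = 1 -> envelope_map 1 = 1.
Proof.
have val1 U : val (1 : envelope U d) = delta set0 1 by apply: rmorph1.
move=> phi1; apply: val_inj; change (twisted_map (val (1 : envelope R d)) = val (1 : envelope S d)).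
rewrite !val1.
by apply/ffunP=> I; rewrite !ffunE; case: ifP => // _; apply: zmod_morphism0.
Qed.

Lemma twisted_map_delta J (a : R) :
  twisted_map (delta J a) = delta J (phi a).
Proof. by apply/ffunP=> I; rewrite !ffunE; case: ifP => // _; apply: zmod_morphism0. Qed.

Lemma cover_flatten m (P : {set {set 'I_m}}) : partition P [set: 'I_m] ->
  perm_eq (flatten [seq enum J | J : {set 'I_m} <- enum P]) (enum 'I_m).
Proof.
set s := flatten _; move=> pP; have mem_s : s =i enum 'I_m.
  move=> i; rewrite mem_enum; apply/flattenP.
  have : i \in cover P by rewrite (cover_partition pP) inE.
  case/bigcupP=> J JP iJ; exists (enum J); last by rewrite mem_enum.
  by apply: map_f; rewrite mem_enum.
apply: (uniq_perm _ (enum_uniq _) mem_s); rewrite (eq_uniq _ mem_s) ?enum_uniq //.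
rewrite size_flatten /shape -map_comp sumnE big_map big_enum /= size_enum_ord.
under eq_bigr do rewrite -cardE.
by rewrite -(card_partition pP) cardsT card_ord.
Qed.

(** The arguments a i are attached to disjoint blocks L i of variables. The term
    of a partition P acquires the sign that sorts the variables of the blocks L
    i listed in the order of P. Modulo 2 its exponent is the Koszul exponent of
    that order of the a i, plus a sum over pairs of a symmetric weight [h],
    which does not depend on P. *)
Theorem val_set_cumulant_ord m (y : 'I_m -> envelope R d) (L : 'I_m -> {set 'I_n})
    (a : 'I_m -> R) :
  (forall i j, i != j -> [disjoint L i & L j]) ->
  (forall i, val (y i) = delta (L i) (a i)) ->
  exists e, val (set_cumulant
      (fun J : {set 'I_m} => envelope_map (\prod_(i in J) y i)) [set: 'I_m])
    = delta (\bigcup_i L i) ((-1) ^+ e * cumulant phi (fun i => total_degree d (L i)) a).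
Proof.
move=> dL vy; pose d' i := total_degree d (L i).
pose cL i j := crossing d (L i) (L j).
pose h (i j : 'I_m) := if (i <= j)%N then cL i j else cL j i.
exists (pair_sum h (enum 'I_m)); rewrite /cumulant mulr_sumr (delta_sum d).
rewrite /set_cumulant rmorph_sum; apply: eq_bigr => P pP.
rewrite rmorphM.
pose u (J : {set 'I_m}) := \prod_(i <- enum J) a i.
pose LL (J : {set 'I_m}) := \bigcup_(i <- enum J) L i.
have vJ (J : {set 'I_m}) : val (envelope_map (\prod_(i in J) y i))
    = delta (LL J) ((-1) ^+ pair_sum cL (enum J) * phi (u J)).
  change (twisted_map (val (\prod_(i in J) y i))
    = delta (LL J) ((-1) ^+ pair_sum cL (enum J) * phi (u J))).
  have -> : val (\prod_(i in J) y i) = \prod_(i <- enum J) (delta (L i) (a i) : twisted R d).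
    by rewrite -big_enum rmorph_prod; apply: eq_bigr => i _; apply: vy.
  rewrite (@prod_delta _ _ _ _ L a) ?enum_uniq // => [|i j _ _]; last exact: dL.
  by rewrite twisted_map_delta zmod_morphism_sign.
rewrite [X in _ * X = _](_ : _ = \prod_(J <- enum P)
  (delta (LL J) ((-1) ^+ pair_sum cL (enum J) * phi (u J)) : twisted S d)); last first.
  by rewrite -big_enum rmorph_prod; apply: eq_bigr => J _; apply: vJ.
have dLL : {in enum P &, forall J J', J != J' -> [disjoint LL J & LL J']}.
  move=> J J'; rewrite !mem_enum => JP J'P nJJ'.
  apply: disjoint_bigcup_seq => j jJ'; rewrite disjoint_sym.
  apply: disjoint_bigcup_seq => i iJ; apply: dL.
  move: jJ' iJ; rewrite !mem_enum => jJ' iJ; apply: contraTneq jJ' => ->.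
  by rewrite (disjointFr (trivIsetP (partition_trivIset pP) _ _ JP J'P nJJ')).
rewrite (@prod_delta _ _ _ _ LL) ?enum_uniq // prod_sign.
have flatP := cover_flatten pP; set s := flatten _ in flatP *.
have -> : \bigcup_(J <- enum P) LL J = \bigcup_i L i.
  transitivity (\bigcup_(i <- enum 'I_m) L i); last by rewrite big_enum.
  by rewrite -(perm_big _ flatP) big_flatten big_map.
rewrite rmorphM rmorph_sign rmorph_nat -delta_coef; congr delta.
rewrite -/(u _) [X in _ * X = _]mulrA -exprD.
have <- : koszul_exp d' s = koszul_exp (fun i => total_degree d (L i)) s by [].
(* The signs produced inside and between the blocks of P add up to the sum over the
   pairs of the concatenated list. *)
rewrite [X in _ * (X * _) = _](@eq_sign _ _ (pair_sum h (enum 'I_m) + koszul_exp d' s)).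
  by rewrite exprD !mulrA; congr (_ * _ * _); rewrite commr_sign mulrA.
have LLE : {in enum P &, forall J J', (J != J') ->
    odd (crossing d (LL J) (LL J')) = odd (\sum_(i <- enum J) \sum_(j <- enum J') cL i j)}.
  move=> J J' _ _ _; rewrite /LL cross_bigcupl ?enum_uniq // => [|i j _ _]; last exact: dL.
  congr odd; apply: eq_bigr => i _; rewrite cross_bigcup ?enum_uniq // => j l _ _.
  exact: dL.
rewrite oddD (eq_odd_pair_sum _ LLE) ?enum_uniq // -oddD addnC -pair_sum_flatten -/s.
rewrite koszul_expE -(pair_sum_perm _ flatP) -?pair_sum_split; last first.
  by move=> i j; rewrite /h; case: (ltngtP i j) => // /val_inj ->.
apply: eq_odd_pair_sum; first by rewrite (perm_uniq flatP) enum_uniq.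
move=> i j _ _ nij; rewrite /h /koszul_inversion; case: ltngtP => [ij|ji|/val_inj eij] /=.
- have := odd_cross_sym d (dL i j nij); rewrite -/(cL i j) -/(cL j i) !oddD oddb => <-.
  by rewrite addbCA addbb addbF.
- by rewrite addn0.
- by rewrite eij eqxx in nij.
Qed.

(** The arguments of a cumulant on a set Q are numbered by [enum_val]. Any
    numbering would do, as the sign is arbitrary. *)
Corollary val_set_cumulant (T : finType) (y : T -> envelope R d)
    (L : T -> {set 'I_n}) (a : T -> R) (Q : {set T}) :
  {in Q &, forall i j, i != j -> [disjoint L i & L j]} ->
  {in Q, forall i, val (y i) = delta (L i) (a i)} ->
  exists e, val (set_cumulant
      (fun J : {set T} => envelope_map (\prod_(i in J) y i)) Q)
    = delta (\bigcup_(i in Q) L i) ((-1) ^+ e *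
        cumulant phi (fun i => total_degree d (L (enum_val i))) (fun i : 'I_#|Q| => a (enum_val i))).
Proof.
move=> dL vy; pose h (i : 'I_#|Q|) : T := enum_val i.
have QE : Q = h @: [set: 'I_#|Q|].
  apply/setP=> x; apply/idP/imsetP => [xQ|[i _ ->]]; last exact: enum_valP.
  by exists (enum_rank_in xQ x); rewrite /h ?enum_rankK_in ?inE.
have [|i|e eE] := @val_set_cumulant_ord #|Q| (y \o h) (L \o h) (a \o h).
- move=> i j nij; apply: dL; rewrite ?enum_valP //.
  by rewrite (inj_eq enum_val_inj).
- by apply: vy; apply: enum_valP.
exists e; rewrite {1}QE set_cumulant_imset; last exact: enum_val_inj.
rewrite [X in delta X _](_ : _ = \bigcup_i (L \o h) i); last first.
  rewrite {1}QE big_imset /= => [|i j _ _]; last exact: enum_val_inj.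
  by apply: eq_bigl => i; rewrite inE.
rewrite -eE; congr (val _); apply: eq_bigr => P _; congr (_ * _).
apply: eq_bigr => J _; congr envelope_map.
by rewrite big_imset //= => i j _ _; apply: enum_val_inj.
Qed.

End EnvelopeMap.

(** * Power series: grading and divisibility by powers of t *)

Lemma series_mulE (R : pzRingType) (u v : series R) n :
  (u * v) n = \sum_(i < n.+1) u i * v (n - i)%N.
Proof. by []. Qed.

Section SeriesGraded.
Variables (K : fieldType) (k : int) (odd_k : odd `|k|%N) (A : gcAlgType K).
Implicit Types u v : series A.

Fact homogB i (a b : A) : a \in homog i -> b \in homog i -> a - b \in homog i.
Proof.
by move=> ai bi; have := (@homog_submod K A i).2 (-1) b a bi ai; rewrite scaleN1r addrC.
Qed.

Fact homog_sum_closed i (I : Type) (r : seq I) (P : pred I) (F : I -> A) :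
  (forall j, P j -> F j \in homog i) -> \sum_(j <- r | P j) F j \in homog i.
Proof.
move=> Fi; elim/big_ind: _ => // [|x y xi yi]; first exact: (@homog_submod K A i).1.
by have := (@homog_submod K A i).2 1 x y xi yi; rewrite scale1r.
Qed.

Fact series_homog0 i : series_homog k i (0 : series A).
Proof. by move=> n; apply: (@homog_submod K A _).1. Qed.

Fact series_homogB i u v :
  series_homog k i u -> series_homog k i v -> series_homog k i (u - v).
Proof. by move=> hu hv n; apply: homogB. Qed.

Lemma series_homog_const i (a : A) : a \in homog i -> series_homog k i (series_const a).
Proof.
move=> ai [|n]; first by rewrite mul0r subr0.
exact: (@homog_submod K A _).1.
Qed.

Fact series_homog1 : series_homog k 0 (1 : series A).
Proof. exact/series_homog_const/homog1. Qed.

Fact series_homogM i j u v :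
  series_homog k i u -> series_homog k j v -> series_homog k (i + j) (u * v).
Proof.
move=> hu hv n; apply: homog_sum_closed => m _.
have -> : i + j - n%:Z * (1 - k) = (i - m%:Z * (1 - k)) + (j - (n - m)%N%:Z * (1 - k)).
  by have := ltn_ord m; nia.
exact: homogM.
Qed.

(** The variable t has the even degree 1 - k, so it does not affect parities. *)
Lemma odd_shift (i : int) (m : nat) : odd `|(i - m%:Z * (1 - k))%R|%N = odd `|i|%N.
Proof.
have [q ->] : exists q : int, k = 2 * q + 1.
  by exists ((k - 1) %/ 2)%Z; lia.
have -> : i - m%:Z * (1 - (2 * q + 1)) = i + 2 * (m%:Z * q) by lia.
by rewrite odd_abszD abszM oddM addbF.
Qed.

Fact series_homogC i j u v : series_homog k i u -> series_homog k j v ->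
  v * u = (-1) ^+ (odd `|i|%N && odd `|j|%N) * (u * v).
Proof.
move=> hu hv; apply/funext => n.
have -> : ((-1) ^+ (odd `|i|%N && odd `|j|%N) * (u * v) : series A) n
   = (-1) ^+ (odd `|i|%N && odd `|j|%N) * (u * v) n.
  by rewrite !mulr_sign; case: ifP.
rewrite !series_mulE mulr_sumr [LHS](reindex_inj rev_ord_inj) /=.
apply: eq_bigr => m _; rewrite subSS.
have -> : (n - (n - m))%N = m by have := ltn_ord m; lia.
by rewrite (homogC (hu m) (hv (n - m)%N)) !odd_shift.
Qed.

Definition series_gradedRing : gradedRing :=
  GradedRing series_homog0 series_homogB series_homog1 series_homogM series_homogC.

End SeriesGraded.

Section ModT.
Variables (K : fieldType) (A : unitalAlg K).
Implicit Types u v : series A.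

Lemma series_scaleE (c : series K) u n :
  (c *: u) n = \sum_(i < n.+1) c i *: u (n - i)%N.
Proof. by []. Qed.

Lemma tvar_scaleE u n : (tvar K *: u) n = if n is m.+1 then u m else 0.
Proof.
rewrite series_scaleE; case: n => [|n].
  by rewrite big_ord_recl big_ord0 scale0r addr0.
rewrite big_ord_recl scale0r add0r big_ord_recl /= subn1 /= scale1r big1 ?addr0 // => i _.
by rewrite scale0r.
Qed.

Lemma tvar_expE p u n : (tvar K ^+ p *: u) n = if (n < p)%N then 0 else u (n - p)%N.
Proof.
elim: p n => [|p IHp] n; first by rewrite expr0 scale1r subn0.
by rewrite exprS -scalerA tvar_scaleE; case: n => [|n] //; rewrite IHp.
Qed.

Lemma eq0_mod_tP p u : eq0_mod_t p u <-> forall n, (n < p)%N -> u n = 0.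
Proof.
split=> [[v ->] n np|u0]; first by rewrite tvar_expE np.
exists (fun n => u (p + n)%N); apply/funext => n; rewrite tvar_expE.
by case: ltnP => [/u0 // | pn]; rewrite subnKC.
Qed.

Lemma eq0_mod_t0 u : eq0_mod_t 0 u.
Proof. by apply/eq0_mod_tP. Qed.

Lemma eq0_mod_t_le p q u : (p <= q)%N -> eq0_mod_t q u -> eq0_mod_t p u.
Proof. by move=> pq /eq0_mod_tP u0; apply/eq0_mod_tP => n np; apply/u0/(leq_trans np). Qed.

Lemma eq0_mod_tD p u v : eq0_mod_t p u -> eq0_mod_t p v -> eq0_mod_t p (u + v).
Proof.
move=> /eq0_mod_tP u0 /eq0_mod_tP v0; apply/eq0_mod_tP => n np.
by rewrite -[LHS]/(u n + v n) u0 // v0 // addr0.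
Qed.

Lemma eq0_mod_t_sum p (I : Type) (r : seq I) (P : pred I) (F : I -> series A) :
  (forall i, P i -> eq0_mod_t p (F i)) -> eq0_mod_t p (\sum_(i <- r | P i) F i).
Proof.
move=> F0; apply: (big_ind (eq0_mod_t p)) => //; first exact/eq0_mod_tP.
exact: eq0_mod_tD.
Qed.

Lemma eq0_mod_t_sign p e u : eq0_mod_t p ((-1) ^+ e * u) <-> eq0_mod_t p u.
Proof.
rewrite -signr_odd mulr_sign; case: odd => //.
rewrite !eq0_mod_tP; split=> u0 n /u0; rewrite -[(- u) n]/(- u n).
  by move/eqP; rewrite oppr_eq0 => /eqP.
by move=> ->; rewrite oppr0.
Qed.

Lemma eq0_mod_t_scale p q u : eq0_mod_t p u -> eq0_mod_t (q + p) (tvar K ^+ q *: u).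
Proof. by case=> v ->; exists v; rewrite scalerA -exprD. Qed.

Lemma tvar_scale_mul u : tvar K *: u = tvar A * u.
Proof.
apply/funext => n; apply: eq_bigr => i _; rewrite /tvar.
by case: eqP; rewrite ?scale1r ?mul1r ?scale0r ?mul0r.
Qed.

Lemma tvar_comm u : GRing.comm u (tvar A).
Proof.
apply/funext => n; rewrite -tvar_scale_mul tvar_scaleE.
rewrite series_mulE (reindex_inj rev_ord_inj) /= -tvar_scaleE series_scaleE; apply: eq_bigr => i _.
rewrite subSS /tvar subKn; last by rewrite -ltnS.
by case: eqP => _; rewrite ?scale1r ?mulr1 ?scale0r ?mulr0.
Qed.

End ModT.

(** * Multilinearity of cumulants *)

Definition update (T : eqType) (V : Type) (u : T -> V) (k : T) (x : V) : T -> V :=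
  fun i => if i == k then x else u i.

Lemma prod_linear (R : pzRingType) (T : eqType) (s : seq T) (k : T)
    (F G H : T -> R) (z : R) : uniq s -> k \in s ->
  {in s, forall i, i != k -> F i = H i /\ G i = H i} ->
  H k = F k + z * G k -> (forall x, GRing.comm x z) ->
  \prod_(i <- s) H i = \prod_(i <- s) F i + z * \prod_(i <- s) G i.
Proof.
move=> us ks FGH Hk zC; elim: s us ks FGH => //= i s IHs /andP[iNs us].
rewrite inE => ks FGH; rewrite !big_cons; have [ki|ki] := altP (k =P i).
  have Es E : (forall j, j \in s -> j != k -> E j = H j) ->
      \prod_(j <- s) E j = \prod_(j <- s) H j.
    move=> EH; apply: eq_big_seq => j js; apply: EH => //.
    by apply: contraNneq iNs => jk; rewrite -ki -jk.
  rewrite -ki Hk !(Es F, Es G) ?mulrDl ?mulrA // => j js nj;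
    by have [] := FGH j _ nj; rewrite ?inE ?js ?orbT.
have [|Fi Gi] := FGH i (mem_head _ _); first by rewrite eq_sym.
rewrite Fi Gi IHs //; last by move=> j js; apply: FGH; rewrite inE js orbT.
  by rewrite mulrDr !mulrA zC.
by move: ks; rewrite (negPf ki).
Qed.

Section CumulantLinear.
Variables (R S : pzRingType) (f : R -> S) (z : R) (z' : S).
Hypotheses (fD : forall x y, f (x + z * y) = f x + z' * f y)
  (zC : forall x : R, GRing.comm x z) (zC' : forall x : S, GRing.comm x z').

(** In each partition the k-th argument enters only through the block containing
    k. The case z = 1 gives additivity; z = t gives K[[t]]-linearity. *)
Lemma cumulant_linear n (d : 'I_n -> int) (u : 'I_n -> R) (k : 'I_n) (x y : R) :
  cumulant f d (update u k (x + z * y))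
  = cumulant f d (update u k x) + z' * cumulant f d (update u k y).
Proof.
rewrite /cumulant mulr_sumr -big_split; apply: eq_bigr => P pP /=.
rewrite [z' * _]mulrA -zC' -[_ * z' * _]mulrA -mulrDr; congr (_ * _).
have kP : k \in cover P by rewrite (cover_partition pP) inE.
have tP := partition_trivIset pP.
apply: (@prod_linear _ _ _ (pblock P k)) => //.
- exact: enum_uniq.
- by rewrite mem_enum pblock_mem.
- move=> J; rewrite mem_enum => JP nJ.
  have kJ : k \notin J by apply: contra nJ => kJ; rewrite (def_pblock tP JP kJ).
  by split; congr f; apply: eq_big_seq => i; rewrite mem_enum /update => iJ;
    case: eqP => // ik; rewrite -ik iJ in kJ.
rewrite -fD; congr f; apply: (@prod_linear _ _ _ k) => //.
- exact: enum_uniq.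
- by rewrite mem_enum mem_pblock.
- by move=> i _ /negPf nik; rewrite /update nik.
- by rewrite /update eqxx.
Qed.

End CumulantLinear.

Lemma eq_cumulant (R S : pzRingType) (f : R -> S) n (d d' : 'I_n -> int)
    (u u' : 'I_n -> R) :
  (forall i, odd `|d i|%N = odd `|d' i|%N) -> u =1 u' ->
  cumulant f d u = cumulant f d' u'.
Proof.
move=> dd uu; apply: eq_bigr => P _; congr (_ * _ ^+ _ * _).
  elim: flatten => //= i s ->; congr addn.
  by apply: eq_count => j; rewrite /= !dd.
by apply: eq_bigr => J _; congr f; apply: eq_bigr => i _.
Qed.

(** The condition on cumulants in the definition of a morphism. *)
Definition cumulants_mod_t (K : fieldType) (A B : gcAlgType K)
    (f : series A -> series B) : Prop :=
  forall n (d : 'I_n -> int) (a : 'I_n -> A), (2 <= n)%N ->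
    (forall i, a i \in homog (d i)) ->
    eq0_mod_t (n - 1) (cumulant f d (fun i => series_const (a i))).

Section MorphismCumulant.
Variables (K : fieldType) (k : int) (odd_k : odd `|k|%N) (A B : gcAlgType K).
Variable f : series A -> series B.
Hypothesis f_lin : linear f.
Hypothesis f_cumulant : cumulants_mod_t f.

Let ft u v : f (u + tvar A * v) = f u + tvar B * f v.
Proof. by rewrite addrC -tvar_scale_mul f_lin tvar_scale_mul addrC. Qed.

Lemma series_split (u : series A) :
  u = series_const (u 0%N) + tvar A * ((fun n => u n.+1) : series A).
Proof.
set v : series A := fun n => u n.+1; rewrite -tvar_scale_mul; apply/funext => n.
rewrite -[RHS]/(series_const (u 0%N) n + (tvar K *: v) n) tvar_scaleE /v.
by case: n => [|n]; rewrite /series_const /= ?addr0 ?add0r.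
Qed.

(** Modulo t^N a cumulant sees only finitely many coefficients of each argument:
    peel off the constant term and factor t out of the rest, at most N times. *)
Lemma cumulant_coefwise n (d : 'I_n -> int) (u : 'I_n -> series A) (i : 'I_n)
    (x : series A) N :
  (forall r, eq0_mod_t N (cumulant f d (update u i (series_const (x r))))) ->
  eq0_mod_t N (cumulant f d (update u i x)).
Proof.
move=> xN; suff: forall M y, (M <= N)%N ->
    (forall r, eq0_mod_t N (cumulant f d (update u i (series_const (y r))))) ->
    eq0_mod_t M (cumulant f d (update u i y)) by apply.
elim=> [|M IHM] y MN yN; first exact: eq0_mod_t0.
rewrite [y]series_split (cumulant_linear ft (@tvar_comm K A) (@tvar_comm K B)).
apply: eq0_mod_tD; first exact: eq0_mod_t_le (yN 0%N).
rewrite -tvar_scale_mul -[M.+1]/(1 + M)%N -[tvar K]expr1; apply: eq0_mod_t_scale.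
by apply: IHM; [exact: ltnW | move=> r; apply: yN].
Qed.

Lemma cumulant_tvar n (d : 'I_n -> int) (u : 'I_n -> series A) (i : 'I_n)
    (x : series A) p :
  cumulant f d (update u i (tvar K ^+ p *: x))
  = tvar K ^+ p *: cumulant f d (update u i x).
Proof.
have lin := cumulant_linear ft (@tvar_comm K A) (@tvar_comm K B) d u i.
have f1 y y' : f (y + 1 * y') = f y + 1 * f y' by rewrite !mul1r -[y]scale1r f_lin !scale1r.
have lin1 := cumulant_linear f1 (fun x => commr1 x) (fun x => commr1 x) d u i 0 0.
have c0 : cumulant f d (update u i 0) = 0.
  by move: lin1; rewrite !mul1r addr0 => /esym/eqP; rewrite -subr_eq0 addrK => /eqP.
elim: p => [|p IHp]; first by rewrite !scale1r.
rewrite exprS -!scalerA -IHp tvar_scale_mul -[tvar A * _]add0r lin c0 add0r.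
by rewrite tvar_scale_mul.
Qed.

(** By K[[t]]-multilinearity. The arguments are replaced one at a time: t^(p i)
    is factored out of the i-th one, and the quotient is replaced by its
    coefficients, which are homogeneous of the same parity as the argument. In
    the induction below, the arguments from m on are already constant. *)
Theorem cumulant_series n (d : 'I_n -> int) (u : 'I_n -> series A) (p : 'I_n -> nat) :
  (0 < n)%N -> (forall i, series_homog k (d i) (u i)) ->
  (forall i, eq0_mod_t (p i) (u i)) ->
  eq0_mod_t (n - 1 + \sum_i p i) (cumulant f d u).
Proof.
move=> n0 hu pu; suff: forall m d u p, (m <= n)%N -> 
    (forall i, series_homog k (d i) (u i)) -> (forall i, eq0_mod_t (p i) (u i)) ->
    (forall i : 'I_n, (m <= i)%N -> p i = 0%N /\ exists b : A, u i = series_const b) ->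
    eq0_mod_t (n - 1 + \sum_i p i) (cumulant f d u).
  by move/(_ n d u p); apply => // i; rewrite leqNgt ltn_ord.
move=> {d u p hu pu}; elim=> [|m IHm] d u p mn hu pu uc.
  rewrite big1 ?addn0 => [|i _]; last by case: (uc i isT).
  have [n1|n2] := leqP n 1.
    by move: n1; rewrite -subn_eq0 => /eqP->; apply: eq0_mod_t0.
  have uE i : u i = series_const (u i 0%N) by have [_ [b ->]] := uc i isT.
  rewrite (eq_cumulant _ (fun i => erefl _) uE); apply: f_cumulant => // i.
  by have := hu i 0%N; rewrite mul0r subr0.
pose i := Ordinal mn; have [v ui] := pu i.
have -> : cumulant f d u = tvar K ^+ p i *: cumulant f d (update u i v).
  rewrite -cumulant_tvar -ui; apply: eq_cumulant => // j.
  by rewrite /update; case: eqP => [->|].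
rewrite (bigD1 i) //= addnCA; apply: eq0_mod_t_scale; apply: cumulant_coefwise => r.
set q := (p i + r)%N; have vE : v r = u i q.
  by rewrite ui tvar_expE /q ltnNge leq_addr /= addKn.
have hvr : v r \in homog (d i - q%:Z * (1 - k)) by rewrite vE; apply: hu.
rewrite (@eq_cumulant _ _ _ _ _ (update d i (d i - q%:Z * (1 - k))) _
  (update u i (series_const (v r)))) //; last first.
  by move=> j; rewrite /update; case: eqP => [->|//]; rewrite odd_shift.
have -> : (\sum_(j < n | j != i) p j = \sum_j update p i 0 j)%N.
  rewrite [RHS](bigD1 i) //= {1}/update eqxx add0n.
  by apply: eq_bigr => j /negPf nj; rewrite /update nj.
apply: IHm => [|j|j|j mj]; first exact: ltnW.
- by rewrite /update; case: eqP => // _; apply: series_homog_const.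
- by rewrite /update; case: eqP => // _; apply: eq0_mod_t0.
rewrite /update; case: eqP => [_|nj]; first by split=> //; exists (v r).
apply: uc; rewrite ltn_neqAle mj andbT; apply/eqP => mj'.
by apply: nj; apply: val_inj.
Qed.

End MorphismCumulant.

(** * Composition of morphisms *)

Section EnvelopeSeries.
Variables (K : fieldType) (k : int) (odd_k : odd `|k|%N).
Variables (n : nat) (d : 'I_n -> int).
Local Notation env A := (envelope (series_gradedRing odd_k A) d).

Lemma linear_zmod_morphism (A B : gcAlgType K) (f : series A -> series B) :
  linear f -> zmod_morphism f.
Proof. by move=> f_lin u v; rewrite addrC -scaleN1r f_lin scaleN1r addrC. Qed.

Lemma series_degree0 (A B : gcAlgType K) (f : series A -> series B) :
  series_degree k 0 f ->
  forall i u, series_homog k i u -> series_homog k i (f u).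
Proof. by move=> f_deg i u hu; have := f_deg i u hu; rewrite addr0. Qed.

Section Mod.
Variables (A B : gcAlgType K) (f : series A -> series B).
Hypotheses (f_lin : linear f) (f_deg : series_degree k 0 f).
Hypothesis f_cumulant : cumulants_mod_t f.

Definition series_envelope_map : env A -> env B :=
  @envelope_map (series_gradedRing odd_k A) (series_gradedRing odd_k B) f
    (series_degree0 f_deg) n d.

(** Combines [val_set_cumulant] and [cumulant_series]. It is used twice: for the
    cumulants of f, with singletons L i and p = 0; then for the cumulants of g
    on the cumulants of f, with L the identity and p J = #|J| - 1. *)
Lemma set_cumulant_mod (T : finType) (y : T -> env A) (L : T -> {set 'I_n})
    (a : T -> series A) (p : T -> nat) (Q : {set T}) : Q != set0 ->
  {in Q &, forall i j, i != j -> [disjoint L i & L j]} ->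
  {in Q, forall i, val (y i) = delta (L i) (a i : series_gradedRing odd_k A)} ->
  {in Q, forall i, eq0_mod_t (p i) (a i)} ->
  exists2 v : series_gradedRing odd_k B,
    val (set_cumulant (fun J : {set T} => series_envelope_map (\prod_(i in J) y i)) Q)
      = delta (\bigcup_(i in Q) L i) v
    & eq0_mod_t (#|Q| - 1 + \sum_(i in Q) p i) (v : series B).
Proof.
move=> Q0 dL vy ap.
have [e ->] := @val_set_cumulant (series_gradedRing odd_k A) (series_gradedRing odd_k B)
  f (linear_zmod_morphism f_lin) (series_degree0 f_deg) n d T y L a Q dL vy.
eexists; first by reflexivity.
apply/eq0_mod_t_sign; rewrite (big_enum_val (A := mem Q)).
apply: (cumulant_series odd_k) => // [|i|i].
- by rewrite card_gt0.
- have := envelopeP (y (enum_val i)) (L (enum_val i)).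
  by rewrite vy ?enum_valP // ffunE eqxx.
- by apply: ap; apply: enum_valP.
Qed.

End Mod.
End EnvelopeSeries.

(** In the composition rule, each partition P contributes a term divisible by t
    to the power #|P| - 1 + \sum_(J in P) (#|J| - 1) = n - 1. *)
Theorem cumulants_mod_t_comp (K : fieldType) (k : int) (odd_k : odd `|k|%N)
    (A B C : gcAlgType K) (f : series A -> series B) (g : series B -> series C) :
  linear f -> series_degree k 0 f -> f 1 = 1 -> cumulants_mod_t f ->
  linear g -> series_degree k 0 g -> g 1 = 1 -> cumulants_mod_t g ->
  cumulants_mod_t (g \o f).
Proof.
move=> f_lin f_deg f1 f_cum g_lin g_deg g1 g_cum n d a n2 ha.
have hx i : gr_homog (total_degree d [set i]) (series_const (a i) : series_gradedRing odd_k A).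
  by rewrite /total_degree big_set1; apply: series_homog_const.
pose x i : envelope (series_gradedRing odd_k A) d := Envelope (homogeneous_delta (hx i)).
have dx : forall i j : 'I_n, i != j -> [disjoint [set i] & [set j]].
  by move=> i j nij; rewrite disjoints1 inE.
pose ef := @series_envelope_map K k odd_k n d A B f f_deg.
pose eg := @series_envelope_map K k odd_k n d B C g g_deg.
pose F (J : {set 'I_n}) := ef (\prod_(i in J) x i).
have F0 : F set0 = 1.
  by rewrite /F big_set0; apply: envelope_map1 => //; apply: linear_zmod_morphism.
have F_mod (J : {set 'I_n}) : J != set0 -> exists2 v : series_gradedRing odd_k B,
    val (set_cumulant F J) = delta J v & eq0_mod_t (#|J| - 1) (v : series B).
  move=> J0; have := @set_cumulant_mod K k odd_k n d A B f f_lin f_deg f_cum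
    'I_n x (fun i => [set i]) (fun i => series_const (a i)) (fun _ => 0%N) J J0.
  case=> [i j _ _|//|i _|v ev ov]; [exact: dx | exact: eq0_mod_t0 |].
  exists v; last by move: ov; rewrite big1_eq addn0.
  rewrite ev; congr delta.
  by apply/setP=> i; apply/bigcupP/idP => [[j jJ /set1P -> //]|iJ]; exists i; rewrite ?inE.
pose w J : series B := val (set_cumulant F J) J.
have w_val (J : {set 'I_n}) : J != set0 ->
    val (set_cumulant F J) = delta J (w J : series_gradedRing odd_k B).
  by case/F_mod=> v ev _; rewrite /w ev ffunE eqxx.
have w_mod (J : {set 'I_n}) : J != set0 -> eq0_mod_t (#|J| - 1) (w J).
  by case/F_mod=> v ev ov; rewrite /w ev ffunE eqxx.
have gf_deg : series_degree k 0 (g \o f).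
  by move=> i u hu; apply: series_degree0 g_deg _ _ (f_deg i u hu).
have gf_lin : linear (g \o f) by move=> c u v; rewrite /= f_lin g_lin.
have [e eE] := @val_set_cumulant_ord (series_gradedRing odd_k A)
  (series_gradedRing odd_k C) (g \o f) (linear_zmod_morphism gf_lin)
  (series_degree0 gf_deg) n d n x (fun i => [set i]) (fun i => series_const (a i))
  dx (fun i => erefl _).
have eE' : val (set_cumulant (eg \o F) [set: 'I_n]) [set: 'I_n]
    = (-1) ^+ e * cumulant (g \o f) d (fun i => series_const (a i)).
  have -> : set_cumulant (eg \o F) [set: 'I_n] = set_cumulant (fun J : {set 'I_n} =>
      @envelope_map (series_gradedRing odd_k A) (series_gradedRing odd_k C) (g \o f)
        (series_degree0 gf_deg) n d (\prod_(i in J) x i)) [set: 'I_n].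
    apply: eq_bigr => P _; congr (_ * _); apply: eq_bigr => J _.
    by apply: val_inj; apply/ffunP=> I; rewrite !ffunE.
  rewrite eE ffunE ifT.
    by congr (_ * _); apply: eq_cumulant => // i; rewrite /total_degree big_set1.
  by apply/eqP/setP=> i; rewrite inE; apply/esym/bigcupP; exists i; rewrite ?inE.
apply/(eq0_mod_t_sign _ e); rewrite -eE'.
have T0 : [set: 'I_n] != set0.
  by rewrite -card_gt0 cardsT card_ord (leq_trans _ n2).
rewrite set_cumulant_comp //; first last.
- by apply: envelope_map1 => //; apply: linear_zmod_morphism.
- exact: (@envelope_map_zmod_morphism (series_gradedRing odd_k B)
    (series_gradedRing odd_k C) g (linear_zmod_morphism g_lin)).
rewrite rmorph_sum /= sum_ffunE; apply: eq0_mod_t_sum => P pP.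
have P0 J : J \in P -> J != set0 by apply: partition_neq0 pP.
have [||J JP|J JP|v -> ov] := @set_cumulant_mod K k odd_k n d B C g g_lin g_deg g_cum
  {set 'I_n} (set_cumulant F) id w (fun J => (#|J| - 1)%N) P.
- apply: contraNneq T0 => P0'; rewrite -(cover_partition pP) P0'.
  by rewrite /cover big_set0.
- exact/trivIsetP/(partition_trivIset pP).
- exact/w_val/P0.
- exact/w_mod/P0.
rewrite ffunE -/(cover P) (cover_partition pP) eqxx.
suff -> : (n - 1 = #|P| - 1 + \sum_(J in P) (#|J| - 1))%N by [].
have : (\sum_(J in P) (#|J| - 1) + #|P| = n)%N.
  rewrite -[RHS]card_ord -cardsT (card_partition pP) -sum1_card -big_split /=.
  by apply: eq_bigr => J /P0; rewrite -card_gt0 => J0; rewrite subnK.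
have : (0 < #|P|)%N.
  rewrite card_gt0; apply: contraNneq T0 => P0'; rewrite -(cover_partition pP) P0'.
  by rewrite /cover big_set0.
by lia.
Qed.

Theorem proposition2p8 (K : fieldType) (charK0 : [pchar K] =i pred0)
  (k : int) (odd_k : odd `|k|%N) (A B C : gcAlgType K)
  (DeltaA : series A -> series A) (DeltaB : series B -> series B)
  (DeltaC : series C -> series C)
  (hA : derived_BV k DeltaA) (hB : derived_BV k DeltaB)
  (hC : derived_BV k DeltaC)
  (f : series A -> series B) (g : series B -> series C)
  (hf : derived_BV_morphism k DeltaA DeltaB f)
  (hg : derived_BV_morphism k DeltaB DeltaC g) :
  derived_BV_morphism k DeltaA DeltaC (g \o f).
Proof.
case: hf => f_lin f_deg f1 f_comm f_cum; case: hg => g_lin g_deg g1 g_comm g_cum.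
split.
- by move=> c u v; rewrite /= f_lin g_lin.
- by move=> e u hu; have := g_deg _ _ (f_deg _ _ hu); rewrite addr0.
- by rewrite /= f1.
- by move=> u; rewrite /= f_comm g_comm.
exact: (cumulants_mod_t_comp odd_k f_lin f_deg f1 f_cum g_lin g_deg g1 g_cum).
Qed.
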